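(* Let $1\to H\xrightarrow{f}G\xrightarrow{g}G/H\to1$ be a short exact sequence of groups, where $H$ and $G$ are equipped with conjugation invariant norms $\|\cdot\|_H$, $\|\cdot\|_G$ such that $\|\cdot\|_G$ is the word norm generated by a set $S\subset G$ and $f$ is a quasi-isometric embedding, and let $\|\cdot\|_{G/H}$ be the word norm on $G/H$ generated by $g(S)$. Additionally assume that there exist a constant $C>0$ and a linearly bounded collection $\{a_i\}_{i\in I}$ of coset representatives of $H$ in $G$ satisfying $\|a_ia_j^{-1}\|_G\le C\|g(a_i)g(a_j)^{-1}\|_{G/H}$ for all $i,j$. Let $\omega$ be a non-principal ultrafilter on $\mathbb{N}$. Then the right section of sets $r:G/H\to G$ defined by $r(g(a_i))=a_i$ is Lipschitz. The induced map $\widehat r:\mathrm{Cone}_\omega(G/H,\|\cdot\|_{G/H})\to\mathrm{Cone}_\omega(G,\|\cdot\|_G)$, $[x_n]\mapsto[r(x_n)]$, is a continuous right section of the short exact sequence $$1\to \mathrm{Cone}_\omega(H,\|\cdot\|_H)\xrightarrow{\widehat f}\mathrm{Cone}_\omega(G,\|\cdot\|_G)\xrightarrow{\widehat g}\mathrm{Cone}_\omega(G/H,\|\cdot\|_{G/H})\to1$$ (with $\widehat f([x_n])=[f(x_n)]$, $\widehat g([x_n])=[g(x_n)]$), and there exists a homeomorphism $$\mathrm{Cone}_\omega(G,\|\cdot\|_G)\cong\mathrm{Cone}_\omega(H,\|\cdot\|_H)\times\mathrm{Cone}_\omega(G/H,\|\cdot\|_{G/H}).$$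
   Context: A norm on a group $G$ is $\nu:G\to[0,\infty)$ with $\nu(g)=0$ iff $g=1$, $\nu(gh)\le\nu(g)+\nu(h)$ and $\nu(g^{-1})=\nu(g)$; it is conjugation invariant if $\nu(hgh^{-1})=\nu(g)$. It induces the metric $d(g,h)=\nu(gh^{-1})$. The conjugation invariant word norm generated by $S\subset G$ is the minimal number of factors needed to write an element as a product of conjugates of elements of $S\cup S^{-1}$ (these conjugates being assumed to generate $G$). A map $f:(X,d)\to(X',d')$ is a quasi-isometric embedding if there are $A\ge1$, $B\ge0$ with $\frac1Ad(x,y)-B\le d'(f(x),f(y))\le Ad(x,y)+B$ for all $x,y$. A collection of coset representatives $\{a_i\}$ (one for each coset of $H$) is linearly bounded if there are positive constants $C',D$ with $\|a_i\|_G\le C'\|g(a_i)\|_{G/H}+D$ for all $i$. Asymptotic cone (scaling sequence $s_n=n$): a sequence $(x_n)_{n\ge1}$ in $G$ is admissible if $\|x_n\|/n$ is bounded; $\mathrm{Cone}_\omega(G,\|\cdot\|)$ is the set of admissible sequences modulo $(x_n)\sim(y_n)$ iff $\lim_\omega d(x_n,y_n)/n=0$, with metric $\lim_\omega d(x_n,y_n)/n$. For a conjugation invariant norm it is a topological group under termwise multiplication. *)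

(* Defs.v *)
From HB Require Import structures.
From mathcomp Require Import all_boot all_order all_algebra.
From mathcomp Require Import all_classical all_reals all_analysis.

Set Implicit Arguments.
Unset Strict Implicit.
Unset Printing Implicit Defensive.

Import Order.TTheory GRing.Theory Num.Theory.
Import numFieldNormedType.Exports.

Local Open Scope classical_set_scope.
Local Open Scope quotient_scope.
Local Open Scope ring_scope.

Record cinorm (R : realType) (G : groupType) := CInorm {
  cinorm_fun :> G -> R ;
  cinorm_ge0 : forall g, 0 <= cinorm_fun g ;
  cinorm_eq0 : forall g, cinorm_fun g = 0 <-> g = 1%g ;
  cinormM : forall g h, cinorm_fun (g * h)%g <= cinorm_fun g + cinorm_fun h ;
  cinormV : forall g, cinorm_fun g^-1%g = cinorm_fun g ;
  cinormJ : forall g h, cinorm_fun (h * g * h^-1)%g = cinorm_fun g }.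

Definition gdist (R : realType) (G : groupType) (nu : G -> R) (x y : G) : R :=
  nu (x * y^-1)%g.

Definition conj_generator (G : groupType) (S : set G) : set G :=
  [set x | exists s h, (S s \/ S s^-1%g) /\ x = (h * s * h^-1)%g].

Definition is_conj_word (G : groupType) (S : set G) (k : nat) (x : G) : Prop :=
  exists s : 'I_k -> G,
    (forall i, conj_generator S (s i)) /\ x = (\prod_(i < k) s i)%g.

(* In particular the conjugates of S and S^-1 generate G: every x is a word. *)
Definition is_word_norm (R : realType) (G : groupType) (S : set G)
    (nu : G -> R) : Prop :=
  forall x, exists k : nat, [/\ nu x = k%:R, is_conj_word S k x &
    forall m : nat, is_conj_word S m x -> (k <= m)%N].

Definition quasi_isometric_embedding (R : realType) (G1 G2 : groupType)
    (nu1 : G1 -> R) (nu2 : G2 -> R) (f : G1 -> G2) : Prop :=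
  exists A B : R, [/\ 1 <= A, 0 <= B & forall x y,
    A^-1 * gdist nu1 x y - B <= gdist nu2 (f x) (f y)
      <= A * gdist nu1 x y + B].

Definition lipschitz_map (R : realType) (G1 G2 : groupType)
    (nu1 : G1 -> R) (nu2 : G2 -> R) (f : G1 -> G2) : Prop :=
  exists2 K : R, 0 <= K &
    forall x y, gdist nu2 (f x) (f y) <= K * gdist nu1 x y.

Definition short_exact (G1 G2 G3 : groupType)
    (f : {multiplicative G1 -> G2}) (g : {multiplicative G2 -> G3}) : Prop :=
  [/\ injective f, range f = [set x | g x = 1%g] & range g = [set: G3]].

Definition coset_representatives (G1 G2 : groupType)
    (f : {multiplicative G1 -> G2}) (I : Type) (a : I -> G2) : Prop :=
  forall x : G2, exists! i, exists h : G1, a i = (x * f h)%g.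

Definition linearly_bounded (R : realType) (G1 G2 : groupType)
    (nu1 : G1 -> R) (nu2 : G2 -> R) (g : G1 -> G2) (I : Type) (a : I -> G1)
    : Prop :=
  exists C D : R, [/\ 0 < C, 0 < D &
    forall i, nu1 (a i) <= C * nu2 (g (a i)) + D].

Definition homeomorphic (X Y : topologicalType) : Prop :=
  exists (F : X -> Y) (F' : Y -> X),
    [/\ cancel F F', cancel F' F, continuous F & continuous F'].

Section NormTheory.
Variables (R : realType) (G : groupType) (nu : cinorm R G).
Implicit Types x y z : G.
Local Notation d := (gdist nu).

Lemma cinorm1 : nu 1%g = 0.
Proof. exact/cinorm_eq0. Qed.

Lemma gdist_ge0 x y : 0 <= d x y.
Proof. exact: cinorm_ge0. Qed.

Lemma gdistxx x : d x x = 0.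
Proof. by rewrite /gdist mulgV cinorm1. Qed.

Lemma gdistC x y : d x y = d y x.
Proof. by rewrite /gdist -cinormV invgF. Qed.

Lemma gdist_triangle y x z : d x z <= d x y + d y z.
Proof.
rewrite /gdist; apply: le_trans (cinormM _ _ _).
by rewrite mulgA mulgVK.
Qed.

Lemma gdist1 x : d x 1%g = nu x.
Proof. by rewrite /gdist invg1 mulg1. Qed.

Lemma gdistM x x' y y' : d (x * y)%g (x' * y')%g <= d x x' + d y y'.
Proof.
apply: le_trans (gdist_triangle (x * y')%g _ _) _; rewrite [leRHS]addrC lerD//.
  by rewrite /gdist invgM -(mulgA x) (mulgA y) mulgA cinormJ.
by rewrite /gdist invgM mulgA mulgK.
Qed.

Lemma gdistV x y : d x^-1%g y^-1%g = d x y.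
Proof.
rewrite /gdist invgK -(cinormJ nu _ x) mulgA mulgV mul1g.
by rewrite -cinormV invgF.
Qed.

End NormTheory.

(* Sequences are indexed by all of nat; the term of index 0 plays no role:
   it is exempt from the bound below, and contributes v / 0%:R = 0 to limits. *)
Definition admissible (R : realType) (G : groupType) (nu : cinorm R G)
    (x : nat -> G) : Prop :=
  exists K : R, forall n : nat, (0 < n)%N -> nu (x n) / n%:R <= K.

Record admseq (R : realType) (G : groupType) (nu : cinorm R G) := AdmSeq {
  admseq_fun :> nat -> G ;
  admseqP : admissible nu admseq_fun }.

HB.instance Definition _ (R : realType) (G : groupType) (nu : cinorm R G) :=
  gen_eqMixin (admseq nu).
HB.instance Definition _ (R : realType) (G : groupType) (nu : cinorm R G) :=
  gen_choiceMixin (admseq nu).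

Section AdmissibleSequences.
Variables (R : realType) (G : groupType) (nu : cinorm R G).
Implicit Types x y : admseq nu.

Lemma admissible1 : admissible nu (fun=> 1%g).
Proof. by exists 0 => n _; rewrite cinorm1 mul0r. Qed.

Lemma admissibleM x y : admissible nu (fun n => (x n * y n)%g).
Proof.
have [K xK] := admseqP x; have [L yL] := admseqP y.
exists (K + L) => n n0; apply: le_trans (lerD (xK n n0) (yL n n0)).
by rewrite -mulrDl ler_wpM2r ?invr_ge0// cinormM.
Qed.

Lemma admissibleV x : admissible nu (fun n => (x n)^-1%g).
Proof.
by have [K xK] := admseqP x; exists K => n n0; rewrite cinormV xK.
Qed.

Definition adm1 : admseq nu := AdmSeq admissible1.
Definition admM x y : admseq nu := AdmSeq (admissibleM x y).
Definition admV x : admseq nu := AdmSeq (admissibleV x).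

Definition scaled_dist (x y : nat -> G) (n : nat) : R :=
  gdist nu (x n) (y n) / n%:R.

Lemma scaled_dist_ge0 (x y : nat -> G) n : 0 <= scaled_dist x y n.
Proof. by rewrite divr_ge0 ?gdist_ge0. Qed.

Lemma scaled_distC (x y : nat -> G) : scaled_dist x y = scaled_dist y x.
Proof. by apply/funext => n; rewrite /scaled_dist gdistC. Qed.

Lemma scaled_dist_triangle (y x z : nat -> G) n :
  scaled_dist x z n <= scaled_dist x y n + scaled_dist y z n.
Proof.
by rewrite -mulrDl ler_wpM2r ?invr_ge0// gdist_triangle.
Qed.

Lemma scaled_dist_bounded x y :
  exists K : R, forall n, 0 <= scaled_dist x y n <= K.
Proof.
have [K xyK] := admissibleM x (admV y).
exists (Num.max 0 K) => n; rewrite scaled_dist_ge0/= le_max.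
by case: n => [|n]; rewrite ?[X in X || _]lexx /scaled_dist ?invr0 ?mulr0
  ?lexx// (xyK n.+1)// orbT.
Qed.

End AdmissibleSequences.


Section ConeRelation.
Variables (R : realType) (w : set_system nat) (Uw : UltraFilter w).
Variables (G : groupType) (nu : cinorm R G).
Implicit Types x y z : admseq nu.

Lemma scaled_dist_cvg x y : cvg (scaled_dist nu x y @ w).
Proof.
have [K xyK] := scaled_dist_bounded x y.
have cptK : compact `[0 : R, K] by exact: segment_compact.
have /cptK [l [_]] : (scaled_dist nu x y @ w) [set` `[0 : R, K]].
  by apply: nearW => n /=; rewrite in_itv/= xyK.
rewrite cluster_cvgE => -[F FF [Fl wF]].
suff wl : scaled_dist nu x y @ w --> l by exact: cvgP wl.
move=> A /Fl FA; have [//|wA] := in_ultra_setVsetC (scaled_dist nu x y @^-1` A) Uw.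
have FnA : F (~` A) by exact: wF.
by have [t [At nAt]] := filter_ex (filterI FA FnA); case: (nAt At).
Qed.

Definition cone_dist x y : R := lim (scaled_dist nu x y @ w).

Lemma cone_dist_ge0 x y : 0 <= cone_dist x y.
Proof.
apply: limr_ge; first exact: scaled_dist_cvg.
by apply: nearW => n; exact: scaled_dist_ge0.
Qed.

Lemma cone_distxx x : cone_dist x x = 0.
Proof.
rewrite /cone_dist (_ : scaled_dist nu x x = cst 0) ?lim_cst//.
by apply/funext => n; rewrite /scaled_dist gdistxx mul0r.
Qed.

Lemma cone_distC x y : cone_dist x y = cone_dist y x.
Proof. by rewrite /cone_dist scaled_distC. Qed.

Lemma cone_dist_triangle y x z :
  cone_dist x z <= cone_dist x y + cone_dist y z.
Proof.
have cvgd := scaled_dist_cvg; rewrite /cone_dist -limD//.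
apply: ler_lim; [exact: cvgd|exact: is_cvgD|].
by apply: nearW => n; exact: scaled_dist_triangle.
Qed.

Lemma cone_distM x x' y y' :
  cone_dist (admM x y) (admM x' y') <= cone_dist x x' + cone_dist y y'.
Proof.
have cvgd := scaled_dist_cvg; rewrite /cone_dist -limD//.
apply: ler_lim; [exact: cvgd|exact: is_cvgD|].
apply: nearW => n; rewrite /scaled_dist/= -mulrDl.
by rewrite ler_wpM2r ?invr_ge0// gdistM.
Qed.

Lemma cone_distV x y : cone_dist (admV x) (admV y) = cone_dist x y.
Proof.
rewrite /cone_dist; congr (lim (_ @ w)); apply/funext => n.
by rewrite /scaled_dist/= gdistV.
Qed.

Definition cone_equiv x y : bool := `[< scaled_dist nu x y @ w --> 0 >].

Lemma cone_equivE x y : cone_equiv x y = (cone_dist x y == 0).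
Proof.
apply/asboolP/eqP => [|<-]; first exact: cvg_lim.
exact: scaled_dist_cvg.
Qed.

Lemma cone_equiv_refl : reflexive cone_equiv.
Proof. by move=> x; rewrite cone_equivE cone_distxx. Qed.

Lemma cone_equiv_sym : symmetric cone_equiv.
Proof. by move=> x y; rewrite !cone_equivE cone_distC. Qed.

Lemma cone_equiv_trans : transitive cone_equiv.
Proof.
move=> y x z; rewrite !cone_equivE => /eqP xy /eqP yz.
rewrite eq_le cone_dist_ge0 andbT.
by apply: le_trans (cone_dist_triangle y _ _) _; rewrite xy yz addr0.
Qed.

Canonical cone_equiv_rel :=
  EquivRel cone_equiv cone_equiv_refl cone_equiv_sym cone_equiv_trans.

End ConeRelation.

Definition Cone (R : realType) (w : set_system nat) {Uw : UltraFilter w}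
  (G : groupType) (nu : cinorm R G) := {eq_quot cone_equiv_rel Uw nu}.
Arguments Cone {R} w {Uw G} nu.

Section ConeStructure.
Variables (R : realType) (w : set_system nat) (Uw : UltraFilter w).
Variables (G : groupType) (nu : cinorm R G).
Local Notation cone := (Cone w nu).
Implicit Types (x y z : admseq nu) (p q r : cone).

HB.instance Definition _ := Choice.on cone.
HB.instance Definition _ := EqQuotient.on cone.

Definition cone_class x : cone := \pi_cone x.

Lemma cone_class_eq x y :
  cone_class x = cone_class y <-> scaled_dist nu x y @ w --> 0.
Proof.
by split => [/eqmodP/asboolP//|xy]; apply/eqmodP/asboolP.
Qed.

Lemma cone_class_dist0 x y :
  cone_class x = cone_class y <-> cone_dist w x y = 0.
Proof.
split => [/eqmodP/=|xy]; first by rewrite cone_equivE => /eqP.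
by apply/eqmodP; rewrite /= cone_equivE xy.
Qed.

Lemma cone_classK p : cone_class (repr p) = p.
Proof. exact: reprK. Qed.

Lemma cone_dist_repr x : cone_dist w (repr (cone_class x)) x = 0.
Proof. by apply/cone_class_dist0; rewrite cone_classK. Qed.

Definition cone_mdist p q : R := cone_dist w (repr p) (repr q).

Let cone_mdistxx p : cone_mdist p p = 0.
Proof. exact: cone_distxx. Qed.

Let cone_mdist_positivity p q : cone_mdist p q = 0 -> p = q.
Proof. by move=> /cone_class_dist0; rewrite !cone_classK. Qed.

Let cone_mdist_sym p q : cone_mdist p q = cone_mdist q p.
Proof. exact: cone_distC. Qed.

Let cone_mdist_triangle q p r :
  cone_mdist p r <= cone_mdist p q + cone_mdist q r.
Proof. exact: cone_dist_triangle. Qed.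

HB.instance Definition _ := @isMetric.Build R cone cone_mdist
  cone_mdistxx cone_mdist_positivity cone_mdist_sym cone_mdist_triangle.

Definition cone_one : cone := cone_class (adm1 nu).
Definition cone_mul p q : cone := cone_class (admM (repr p) (repr q)).
Definition cone_inv p : cone := cone_class (admV (repr p)).

Lemma cone_mulE x y :
  cone_mul (cone_class x) (cone_class y) = cone_class (admM x y).
Proof.
apply/cone_class_dist0/eqP; rewrite eq_le cone_dist_ge0 andbT.
by apply: le_trans (cone_distM _ _ _ _ _) _; rewrite !cone_dist_repr addr0.
Qed.

Lemma cone_invE x : cone_inv (cone_class x) = cone_class (admV x).
Proof. by apply/cone_class_dist0; rewrite cone_distV cone_dist_repr. Qed.

Lemma cone_class_ext x y : x =1 y -> cone_class x = cone_class y.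
Proof.
move=> xy; apply/cone_class_dist0; rewrite -(cone_distxx Uw y).
congr (lim (_ @ w)); apply/funext => n.
by rewrite /scaled_dist xy.
Qed.

Let cone_mulA : associative cone_mul.
Proof.
move=> p q r; rewrite -(cone_classK p) -(cone_classK q) -(cone_classK r).
by rewrite !cone_mulE; apply: cone_class_ext => n /=; rewrite mulgA.
Qed.

Let cone_mul1g : left_id cone_one cone_mul.
Proof.
move=> p; rewrite -(cone_classK p) cone_mulE.
by apply: cone_class_ext => n /=; rewrite mul1g.
Qed.

Let cone_mulg1 : right_id cone_one cone_mul.
Proof.
move=> p; rewrite -(cone_classK p) cone_mulE.
by apply: cone_class_ext => n /=; rewrite mulg1.
Qed.

Let cone_mulVg : left_inverse cone_one cone_inv cone_mul.
Proof.
move=> p; rewrite -(cone_classK p) cone_invE cone_mulE.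
by apply: cone_class_ext => n /=; rewrite mulVg.
Qed.

Let cone_mulgV : right_inverse cone_one cone_inv cone_mul.
Proof.
move=> p; rewrite -(cone_classK p) cone_invE cone_mulE.
by apply: cone_class_ext => n /=; rewrite mulgV.
Qed.

HB.instance Definition _ := @isGroup.Build cone cone_one cone_inv cone_mul
  cone_mulA cone_mul1g cone_mulg1 cone_mulVg cone_mulgV.

Lemma cone_class1 : cone_class (adm1 nu) = 1%g.
Proof. by []. Qed.

Lemma cone_classM x y :
  cone_class (admM x y) = (cone_class x * cone_class y)%g.
Proof. by rewrite -cone_mulE. Qed.

Lemma cone_classV x : cone_class (admV x) = (cone_class x)^-1%g.
Proof. by rewrite -cone_invE. Qed.

Lemma mdist_cone_class x y :
  mdist (cone_class x) (cone_class y) = lim (scaled_dist nu x y @ w).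
Proof.
rewrite -/(cone_dist w x y); apply/eqP; rewrite eq_le; apply/andP; split.
  apply: le_trans (cone_dist_triangle _ x _ _) _.
  rewrite cone_dist_repr add0r.
  apply: le_trans (cone_dist_triangle _ y _ _) _.
  by rewrite [X in _ + X]cone_distC cone_dist_repr addr0.
apply: le_trans (cone_dist_triangle _ (repr (cone_class x)) _ _) _.
rewrite cone_distC cone_dist_repr add0r.
apply: le_trans (cone_dist_triangle _ (repr (cone_class y)) _ _) _.
by rewrite cone_dist_repr addr0.
Qed.

End ConeStructure.
Arguments cone_class {R w Uw G nu} x.

(* F is the well-defined map [x_n] |-> [phi x_n]: the image under phi of any
   admissible sequence is admissible, and its class depends only on [x_n]. *)
Definition induces (R : realType) (w : set_system nat) (Uw : UltraFilter w)
    (G1 G2 : groupType) (nu1 : cinorm R G1) (nu2 : cinorm R G2)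
    (phi : G1 -> G2) (F : Cone w nu1 -> Cone w nu2) : Prop :=
  forall x : admseq nu1, exists2 y : admseq nu2,
    forall n, y n = phi (x n) & F (cone_class x) = cone_class y.

(* Main.v *)
(* The section [r] and, since [g] does not increase word length, the projection
   [g] are Lipschitz, while [f] is bi-Lipschitz up to an additive constant; that
   constant disappears after division by [n] along a non-principal ultrafilter,
   so all three induce Lipschitz maps of cones and [fhat] is bi-Lipschitz onto
   its image.  If [ghat [x_n] = 1], then [x_n r(g(x_n))^-1] lies in [f(H)] and
   still represents [[x_n]], because [rhat 1 = 1]; this gives exactness.  The
   homeomorphism is [p |-> (fhat^-1 (p rhat(ghat p)^-1), ghat p)], with inverse
   [(h, q) |-> fhat h * rhat q]. *)
Require Import Defs.
From HB Require Import structures.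
From mathcomp Require Import all_boot all_order all_algebra.
From mathcomp Require Import all_classical all_reals all_analysis.
Set Implicit Arguments.
Unset Strict Implicit.
Unset Printing Implicit Defensive.
Import Order.TTheory GRing.Theory Num.Theory.
Import numFieldNormedType.Exports.
Local Open Scope classical_set_scope.
Local Open Scope ring_scope.


(** * Homomorphisms, continuity criteria and ultrafilters *)

Lemma multiplicative1 (G1 G2 : groupType) (f : {multiplicative G1 -> G2}) :
  f 1%g = 1%g.
Proof. by apply: (mulgI (f 1%g)); rewrite -gmulfM !mulg1. Qed.

Lemma multiplicativeV (G1 G2 : groupType) (f : {multiplicative G1 -> G2}) :
  {morph f : x / x^-1%g}.
Proof.
by move=> x; apply: (mulgI (f x)); rewrite -gmulfM !mulgV multiplicative1.
Qed.

Lemma lipschitz_continuous (R : realType) (X Y : metricType R) (F : X -> Y)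
    (K : R) :
  (forall p q, mdist (F p) (F q) <= K * mdist p q) -> continuous F.
Proof.
move=> FK p; apply/cvg_ballP => e e0.
(* The sign of [K] is unknown; its absolute value plus one is a positive Lipschitz constant, safe to
   divide by. *)
have K0 : 0 < `|K| + 1 by rewrite ltr_wpDl.
near=> q; rewrite ballEmdist/=; apply: le_lt_trans (FK p q) _.
apply: (@le_lt_trans _ _ ((`|K| + 1) * mdist p q)).
  by rewrite ler_wpM2r ?mdist_ge0// ler_wpDr// ler_norm.
rewrite mulrC -ltr_pdivlMr//.
have : ball p (e / (`|K| + 1)) q.
  by near: q; apply: nbhsx_ballx; rewrite divr_gt0.
by rewrite ballEmdist.
Unshelve. all: by end_near. Qed.

(** The intended [op] is multiplication in a cone. Each argument is allowed an error [e / 2]. *)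
Lemma continuous_op2 (R : realType) (X Y : topologicalType) (Z : metricType R)
    (op : Z -> Z -> Z) (F : X -> Z) (G : Y -> Z) :
  (forall p p' q q', mdist (op p q) (op p' q') <= mdist p p' + mdist q q') ->
  continuous F -> continuous G ->
  continuous (fun u : X * Y => op (F u.1) (G u.2)).
Proof.
move=> opD Fc Gc [p q]; apply/cvg_ballP => e e0 /=.
have e2 : 0 < e / 2 by rewrite divr_gt0.
have Fp : F u.1 @[u --> (p, q)] --> F p.
  by apply: (@cvg_comp _ _ _ fst F _ (nbhs p)); [exact: cvg_fst|exact: Fc].
have Gq : G u.2 @[u --> (p, q)] --> G q.
  by apply: (@cvg_comp _ _ _ snd G _ (nbhs q)); [exact: cvg_snd|exact: Gc].
near=> u; rewrite ballEmdist/=; apply: le_lt_trans (opD _ _ _ _) _.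
rewrite (splitr e) ltrD//.
- have : ball (F p) (e / 2) (F u.1); last by rewrite ballEmdist.
  by near: u; exact: (cvg_ballP _ _).1 Fp _ e2.
- have : ball (G q) (e / 2) (G u.2); last by rewrite ballEmdist.
  by near: u; exact: (cvg_ballP _ _).1 Gq _ e2.
Unshelve. all: by end_near. Qed.

(** If [w] contained a singleton, it would contain a principal filter and equal it by maximality. So
    [w] contains the complement of every point and, by finite intersections, every tail. *)
Lemma nonprincipal_ultra_infty (w : set_system nat) (Uw : UltraFilter w) :
  (forall n, w <> principal_filter n) -> \oo `<=` w.
Proof.
move=> np A [N _ NA].
have wD n : w (~` [set n]).
  have [wn|//] := in_ultra_setVsetC [set n] Uw; case: (np n).
  apply: (@max_filter _ _ (principal_filter_ultra n)) => B nB.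
  by apply: filterS wn => m ->; exact: nB.
have : w (fun m => (N <= m)%N).
  elim: N {NA} => [|N IH]; first exact: nearW.
  apply: filterS (filterI IH (wD N)) => m [Nm mN].
  by rewrite ltn_neqAle Nm andbT eq_sym; apply/eqP.
exact: filterS.
Qed.

(** * Coarsely Lipschitz maps and the maps they induce on cones *)

Section CoarseLipschitz.
Variables (R : realType) (w : set_system nat) (Uw : UltraFilter w).
Hypothesis w_infty : \oo `<=` w.
Variables (G1 G2 : groupType) (nu1 : cinorm R G1) (nu2 : cinorm R G2).

(** Division by [n] turns [B] into [B / n], which is eventually at most any [e > 0]. Since sequences
    are compared rather than a map and its values, the estimate can be used in both directions. *)
Lemma mdist_cone_class_le (K B : R) (x y : admseq nu1) (x' y' : admseq nu2) :
  (forall n, gdist nu2 (x' n) (y' n) <= K * gdist nu1 (x n) (y n) + B) ->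
  mdist (cone_class x' : Cone w nu2) (cone_class y')
    <= K * mdist (cone_class x : Cone w nu1) (cone_class y).
Proof.
move=> KB; rewrite !mdist_cone_class; apply/ler_addgt0Pr => e e0.
have cv := @scaled_dist_cvg R w Uw _ nu1 x y.
have cvK : (K * scaled_dist nu1 x y n + e) @[n --> w] -->
    K * lim (scaled_dist nu1 x y @ w) + e.
  by apply: cvgD; [exact: cvgMl_tmp|exact: cvg_cst].
rewrite -(cvg_lim _ cvK)//; apply: ler_lim; first exact: scaled_dist_cvg.
  exact: cvgP cvK.
apply: w_infty; near=> n.
have n0 : 0 < n%:R :> R by rewrite ltr0n; near: n; exact: nbhs_infty_gt.
rewrite /scaled_dist mulrA -lerBlDl.
rewrite -mulrBl ler_pdivrMr// lerBlDl.
apply: le_trans (KB n) _; rewrite lerD2l mulrC -ler_pdivrMr//.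
by near: n; exact: nbhs_infty_ger.
Unshelve. all: by end_near. Qed.

(** The sequence [y] is arbitrary so that it may also consist of preimages under an embedding. *)
Lemma admissible_bound (K B : R) (x : admseq nu1) (y : nat -> G2) :
  0 <= K -> 0 <= B -> (forall n, nu2 (y n) <= K * nu1 (x n) + B) ->
  admissible nu2 y.
Proof.
move=> K0 B0 yK; have [L xL] := admseqP x; exists (K * L + B) => n n0.
have n0' : 0 < n%:R :> R by rewrite ltr0n.
rewrite ler_pdivrMr//; apply: le_trans (yK n) _; rewrite mulrDl lerD//.
  by rewrite -mulrA ler_wpM2l// -ler_pdivrMr// xL.
by rewrite ler_peMr// ler1n.
Qed.

Variables (phi : G1 -> G2) (K B : R).
Hypotheses (K_ge0 : 0 <= K) (B_ge0 : 0 <= B).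

Lemma induces_class F (x : admseq nu1) (y : admseq nu2) :
  induces (w := w) phi F -> y =1 phi \o x -> F (cone_class x) = cone_class y.
Proof.
move=> /(_ x)[z zphi ->] yphi.
by apply: cone_class_ext => n; rewrite zphi yphi.
Qed.

(* [F 1] is the class of the constant sequence [phi 1], whatever [phi 1] is. *)
Lemma induces1 (F : Cone w nu1 -> Cone w nu2) :
  induces phi F -> F 1%g = 1%g.
Proof.
move=> /(_ (adm1 nu1))[y yE]; rewrite !cone_class1 => ->.
apply: mdist_positivity; apply/eqP; rewrite eq_le mdist_ge0 andbT.
(* Writing [0] as a multiple of a distance allows the previous estimate with factor [0] and additive
   constant [nu2 (phi 1)]. *)
rewrite -(mul0r (mdist (1%g : @Cone R w Uw G1 nu1) 1%g)).
apply: (@mdist_cone_class_le 0 (nu2 (phi 1%g))) => n.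
by rewrite mul0r add0r yE /= gdist1.
Qed.

Hypothesis phiK :
  forall x y, gdist nu2 (phi x) (phi y) <= K * gdist nu1 x y + B.

Lemma admissible_coarse (x : admseq nu1) : admissible nu2 (phi \o x).
Proof.
(* Comparison with [phi 1] turns a bound on distances into a bound on norms, at the cost of
   [nu2 (phi 1)]. *)
apply: (@admissible_bound K (B + nu2 (phi 1%g)) x) => //.
  by rewrite addr_ge0// cinorm_ge0.
move=> n /=; rewrite -(gdist1 nu2) -(gdist1 nu1) addrA -(gdist1 nu2 (phi 1%g)).
by apply: le_trans (gdist_triangle _ (phi 1%g) _ _) _; rewrite lerD2r.
Qed.

Lemma induces_exists : exists F : Cone w nu1 -> Cone w nu2,
  induces phi F /\ forall p q, mdist (F p) (F q) <= K * mdist p q.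
Proof.
pose F (p : @Cone R w Uw G1 nu1) : @Cone R w Uw G2 nu2 :=
  cone_class (AdmSeq (admissible_coarse (repr p))).
have FK p q : mdist (F p) (F q) <= K * mdist p q.
  rewrite -{2}(cone_classK p) -{2}(cone_classK q).
  by apply: (@mdist_cone_class_le K B) => n /=.
exists F; split=> // x; exists (AdmSeq (admissible_coarse x)) => //.
apply: mdist_positivity; apply/eqP; rewrite eq_le mdist_ge0 andbT.
(* [F] is computed on a chosen representative; that one and [x] are at cone distance [0], hence so
   are their images. *)
pose y : @Cone R w Uw G1 nu1 := cone_class x.
rewrite -(mulr0 K) -(mdistxx y) -{1}(cone_classK y).
by apply: (@mdist_cone_class_le K B) => n /=.
Qed.

End CoarseLipschitz.

(** This is the estimate on sequences with the two groups exchanged, so no inverse of [phi] is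
    required. *)
Lemma induces_mdist_ge (R : realType) (w : set_system nat)
    (Uw : UltraFilter w) (w_infty : \oo `<=` w) (G1 G2 : groupType)
    (nu1 : cinorm R G1) (nu2 : cinorm R G2) (phi : G1 -> G2)
    (F : Cone w nu1 -> Cone w nu2) (K B : R) :
  induces phi F ->
  (forall x y, gdist nu1 x y <= K * gdist nu2 (phi x) (phi y) + B) ->
  forall p q, mdist p q <= K * mdist (F p) (F q).
Proof.
move=> phiF phiK p q; rewrite -(cone_classK p) -(cone_classK q).
have [x xE ->] := phiF (repr p); have [y yE ->] := phiF (repr q).
by apply: (@mdist_cone_class_le _ _ _ w_infty _ _ _ _ K B) => n; rewrite xE yE.
Qed.

Lemma induces_multiplicative (R : realType) (w : set_system nat)
    (Uw : UltraFilter w) (G1 G2 : groupType)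
    (nu1 : cinorm R G1) (nu2 : cinorm R G2) (phi : {multiplicative G1 -> G2})
    (F : Cone w nu1 -> Cone w nu2) :
  induces phi F -> exists Fm : {multiplicative Cone w nu1 -> Cone w nu2},
    Fm = F :> (_ -> _).
Proof.
move=> phiF.
have FM : {morph F : p q / (p * q)%g}.
  move=> p q; rewrite -(cone_classK p) -(cone_classK q) -cone_classM.
  have [x xE ->] := phiF (repr p); have [y yE ->] := phiF (repr q).
  rewrite -cone_classM; apply: (induces_class phiF) => n /=.
  by rewrite gmulfM xE yE.
pose m := isMultiplicative.Build _ _ F FM.
pose Fm : {multiplicative @Cone R w Uw G1 nu1 -> @Cone R w Uw G2 nu2} :=
  HB.pack F m.
by exists Fm.
Qed.

(** * Splitting a short exact sequence of cones *)

Section ConeGroup.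
Variables (R : realType) (w : set_system nat) (Uw : UltraFilter w).

Lemma mdist_coneM (G : groupType) (nu : cinorm R G) (p p' q q' : Cone w nu) :
  mdist (p * q)%g (p' * q')%g <= mdist p p' + mdist q q'.
Proof.
rewrite -(cone_classK p) -(cone_classK p') -(cone_classK q) -(cone_classK q').
by rewrite -!cone_classM !mdist_cone_class; exact: cone_distM.
Qed.

Lemma mdist_coneV (G : groupType) (nu : cinorm R G) (p q : Cone w nu) :
  mdist p^-1%g q^-1%g = mdist p q.
Proof.
rewrite -(cone_classK p) -(cone_classK q).
by rewrite -!cone_classV !mdist_cone_class; exact: cone_distV.
Qed.

Variables (H G Q : groupType).
Variables (nuH : cinorm R H) (nuG : cinorm R G) (nuQ : cinorm R Q).

Lemma split_cone_homeomorphic (f : {multiplicative Cone w nuH -> Cone w nuG})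
    (g : {multiplicative Cone w nuG -> Cone w nuQ})
    (r : Cone w nuQ -> Cone w nuG) (A K L M : R) :
  0 <= A -> 0 <= L -> short_exact f g -> cancel r g ->
  (forall p q, mdist (f p) (f q) <= K * mdist p q) ->
  (forall p q, mdist p q <= A * mdist (f p) (f q)) ->
  (forall p q, mdist (g p) (g q) <= M * mdist p q) ->
  (forall p q, mdist (r p) (r q) <= L * mdist p q) ->
  homeomorphic (Cone w nuG) (Cone w nuH * Cone w nuQ)%type.
Proof.
move=> A0 L0 [f_inj f_ker _] rK fK fA gM rL.
have fg h : g (f h) = 1%g.
  by have : range f (f h) by []; rewrite f_ker.
have ex_s p : exists h, f h = (p * (r (g p))^-1)%g.
  have : range f (p * (r (g p))^-1)%g.
    by rewrite f_ker/= gmulfM multiplicativeV rK mulgV.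
  by case=> h _ hE; exists h.
have [s sE] := choice ex_s.
(* In [p * (r (g p))^-1] the first factor contributes [1] and the second [L * M]; undoing [f] costs
   [A]. *)
have sK p q : mdist (s p) (s q) <= A * (1 + L * M) * mdist p q.
  apply: le_trans (fA _ _) _; rewrite -mulrA ler_wpM2l// !sE mulrDl mul1r.
  apply: le_trans (mdist_coneM _ _ _ _) _; rewrite lerD2l mdist_coneV.
  by apply: le_trans (rL _ _) _; rewrite -mulrA ler_wpM2l.
exists (fun p => (s p, g p)), (fun u => (f u.1 * r u.2)%g); split.
- by move=> p /=; rewrite sE mulgVK.
- move=> [h q]; congr pair; last by rewrite gmulfM fg rK mul1g.
  by apply: f_inj; rewrite sE /= gmulfM fg rK mul1g mulgK.
- move=> p; have sp := @lipschitz_continuous _ _ _ _ _ sK p.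
  have gp := @lipschitz_continuous _ _ _ _ _ gM p.
  exact: (cvg_pair sp gp).
- apply: (continuous_op2 (@mdist_coneM _ nuG)).
    exact: lipschitz_continuous fK.
  exact: lipschitz_continuous rL.
Qed.

End ConeGroup.

(** * Word norms and coset representatives *)

Lemma is_conj_word_image (G Q : groupType) (g : {multiplicative G -> Q})
    (S : set G) (k : nat) (x : G) :
  is_conj_word S k x -> is_conj_word (g @` S) k (g x).
Proof.
move=> [s [sS ->]]; exists (g \o s); split; last first.
  by rewrite (big_morph g (gmulfM (s:=g)) (multiplicative1 g)).
move=> i /=; have [t [h [tS ->]]] := sS i.
exists (g t), (g h); rewrite !gmulfM multiplicativeV; split=> //.
by case: tS => tS; [left|right]; [exists t|exists t^-1%g; rewrite ?multiplicativeV].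
Qed.

(** A shortest word for [x] is mapped by [g] to a word of the same length for [g x]. *)
Lemma word_norm_image_le (R : realType) (G Q : groupType)
    (g : {multiplicative G -> Q}) (S : set G) (nuG : G -> R) (nuQ : Q -> R) :
  is_word_norm S nuG -> is_word_norm (g @` S) nuQ ->
  forall x, nuQ (g x) <= nuG x.
Proof.
move=> wG wQ x; have [k [-> kx _]] := wG x; have [m [-> _ mx]] := wQ (g x).
by rewrite ler_nat mx//; exact: is_conj_word_image.
Qed.

(** The cosets of [f(H)], the kernel of [g], are the fibres of [g], and each contains exactly one
    [a i]. This makes the section [r] well defined. *)
Lemma coset_representatives_section (H G Q : groupType)
    (f : {multiplicative H -> G}) (g : {multiplicative G -> Q})
    (I : Type) (a : I -> G) :
  short_exact f g -> coset_representatives f a ->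
  injective (g \o a) /\ range (g \o a) = [set: Q].
Proof.
move=> [_ f_ker g_surj] a_reps; split=> [i j /= gij|].
  have : range f ((a j)^-1 * a i)%g.
    by rewrite f_ker/= gmulfM multiplicativeV gij mulVg.
  case=> h _ hE; have [k [_ kU]] := a_reps (a j).
  rewrite -(kU j); last by exists 1%g; rewrite multiplicative1 mulg1.
  by apply/esym/kU; exists h; rewrite hE mulVKg.
rewrite -subTset => q _.
have : range g q by rewrite g_surj.
case=> x _ <-; have [i [[h hE] _]] := a_reps x.
exists i => //=; rewrite hE gmulfM.
have : range f (f h) by [].
by rewrite f_ker/= => ->; rewrite mulg1.
Qed.

(** * The section and the splitting on cones *)

Theorem lemma3p9 (R : realType) (H G Q : groupType)
  (nuH : cinorm R H) (nuG : cinorm R G) (nuQ : cinorm R Q)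
  (f : {multiplicative H -> G}) (g : {multiplicative G -> Q})
  (fg_exact : short_exact f g)
  (S : set G) (word_G : is_word_norm S nuG) (word_Q : is_word_norm (g @` S) nuQ)
  (f_qi : quasi_isometric_embedding nuH nuG f)
  (I : Type) (a : I -> G) (a_reps : coset_representatives f a)
  (a_lin : linearly_bounded nuG nuQ g a)
  (C : R) (C_gt0 : 0 < C)
  (a_C : forall i j : I,
    nuG (a i * (a j)^-1)%g <= C * nuQ (g (a i) * (g (a j))^-1)%g)
  (w : set_system nat) (Uw : UltraFilter w)
  (w_nonprincipal : forall n : nat, w <> principal_filter n) :
  [/\ exists r : Q -> G, forall i : I, r (g (a i)) = a i,
      forall r : Q -> G, (forall i : I, r (g (a i)) = a i) ->
        [/\ cancel r g, lipschitz_map nuQ nuG r &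
          exists (fhat : {multiplicative Cone w nuH -> Cone w nuG})
                 (ghat : {multiplicative Cone w nuG -> Cone w nuQ})
                 (rhat : Cone w nuQ -> Cone w nuG),
            [/\ induces f fhat, induces g ghat & induces r rhat] /\
            [/\ short_exact fhat ghat, continuous fhat, continuous ghat,
                continuous rhat & cancel rhat ghat]]
    & homeomorphic (Cone w nuG) (Cone w nuH * Cone w nuQ)%type].
Proof.
have [ga_inj ga_surj] := coset_representatives_section fg_exact a_reps.
have ga q : exists i, g (a i) = q.
  have : range (g \o a) q by rewrite ga_surj.
  by case=> i _ <-; exists i.
have r_ex : exists r : Q -> G, forall i : I, r (g (a i)) = a i.
  have [k kE] := choice ga.
  by exists (a \o k) => i /=; congr a; apply: ga_inj; rewrite /= kE.
have w_infty := nonprincipal_ultra_infty Uw w_nonprincipal.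
have [_ f_ker _] := fg_exact.
have fgE h : g (f h) = 1%g.
  by have : range f (f h) by []; rewrite f_ker.
have [A [B [A1 B0 f_AB]]] := f_qi.
have A0 : 0 <= A by exact: le_trans A1.
have A_gt0 : 0 < A by exact: lt_le_trans A1.
have f_ub x y : gdist nuG (f x) (f y) <= A * gdist nuH x y + B.
  by have /andP[] := f_AB x y.
(* The lower quasi-isometry bound multiplied by [A]; its additive constant becomes [A * B]. *)
have f_lb x y : gdist nuH x y <= A * gdist nuG (f x) (f y) + A * B.
  have /andP[+ _] := f_AB x y.
  by rewrite lerBlDr ler_pdivrMl// mulrDr.
have AB0 : 0 <= A * B by rewrite mulr_ge0.
have g_ub x y : gdist nuQ (g x) (g y) <= 1 * gdist nuG x y + 0.
  rewrite addr0 mul1r /gdist -multiplicativeV -gmulfM.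
  exact: word_norm_image_le word_G word_Q _.
have [F [fF FA]] := induces_exists Uw w_infty A0 B0 f_ub.
have [fhat fhatE] := induces_multiplicative fF.
have [F' [gF F'1]] := induces_exists Uw w_infty ler01 (lexx 0) g_ub.
have [ghat ghatE] := induces_multiplicative gF.
rewrite -{F}fhatE in fF FA; rewrite -{F'}ghatE in gF F'1.
have FAV := induces_mdist_ge w_infty fF f_lb.
(* Needed twice: for every given [r], and for one chosen [r] to get the homeomorphism. Exactness is
   included because its proof uses [rhat]. *)
have key (r : Q -> G) : (forall i : I, r (g (a i)) = a i) ->
    [/\ cancel r g, lipschitz_map nuQ nuG r &
      exists rhat : Cone w nuQ -> Cone w nuG,
        [/\ induces r rhat, short_exact fhat ghat, cancel rhat ghat &
          forall p q, mdist (rhat p) (rhat q) <= C * mdist p q]].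
  move=> rE.
  have rK : cancel r g by move=> q; have [i <-] := ga q; rewrite rE.
  have r_lip x y : gdist nuG (r x) (r y) <= C * gdist nuQ x y.
    by have [i <-] := ga x; have [j <-] := ga y; rewrite !rE; exact: a_C.
  split=> //; first by exists C; [exact: ltW|].
  have r_ub x y : gdist nuG (r x) (r y) <= C * gdist nuQ x y + 0.
    by rewrite addr0.
  have [rhat [rR rC]] := induces_exists Uw w_infty (ltW C_gt0) (lexx 0) r_ub.
  have rhatK : cancel rhat ghat.
    move=> p; rewrite -(cone_classK p); have [y yE ->] := rR (repr p).
    have [z zE ->] := gF y; apply: cone_class_ext => n.
    by rewrite zE yE rK.
  exists rhat; split=> //; split.
  - move=> p q pq; apply: mdist_positivity; apply/eqP.
    rewrite eq_le mdist_ge0 andbT; apply: le_trans (FAV p q) _.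
    by rewrite pq mdistxx mulr0.
  - apply/seteqP; split=> [_ [p _ <-]|p /=].
      rewrite /= -(cone_classK p); have [y yE ->] := fF (repr p).
      have [z zE ->] := gF y; apply: cone_class_ext => n.
      by rewrite zE yE fgE.
    move=> gp1.
    (* Termwise, [z] is the image of [repr p] under [g], and [y] is [r] applied to [z]; hence
       [repr p n * (y n)^-1] lies in the kernel of [g]. *)
    have [z zE ghatz] := gF (repr p); have [y yE rhaty] := rR z.
    have f_h n : exists h, f h = (repr p n * (y n)^-1)%g.
      have : range f (repr p n * (y n)^-1)%g.
        by rewrite f_ker/= gmulfM multiplicativeV yE rK zE mulgV.
      by case=> h _ hE; exists h.
    have [h hE] := choice f_h.
    (* The lower bound for [f] against [1] controls the norm of [h n] by that of its image. *)
    have h_adm : admissible nuH h.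
      apply: (@admissible_bound _ _ _ nuG nuH A (A * B)
        (admM (repr p) (admV y))) => // n.
      by have := f_lb (h n) 1%g; rewrite multiplicative1 !gdist1 hE.
    exists (cone_class (AdmSeq h_adm)) => //.
    rewrite (induces_class (y := admM (repr p) (admV y)) fF); last first.
      by move=> n /=; rewrite hE.
    (* The class of [y] is [rhat (ghat p)], that is [rhat 1], which is trivial even if [r 1] is
       not. *)
    rewrite cone_classM cone_classV -rhaty -ghatz cone_classK gp1.
    by rewrite (induces1 w_infty rR) invg1 mulg1.
  - by rewrite -subTset => p _; exists (rhat p); rewrite ?rhatK.
split=> [//|r rE|].
  have [rK r_lip [rhat [rR fg_hat rhatK rC]]] := key r rE; split=> //.
  exists fhat, ghat, rhat; split=> //.
  by split=> //; exact: lipschitz_continuous.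
have [r rE] := r_ex; have [_ _ [rhat [_ fg_hat rhatK rC]]] := key r rE.
exact: (split_cone_homeomorphic A0 (ltW C_gt0) fg_hat rhatK FA FAV F'1 rC).
Qed.
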